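(* Let $\mathbb{Q}(i)$ be the quadratic field, where $i^2=-1$, and consider the quaternion algebra $\mathbb{H}_{\mathbb{Q}(i)}(-1,-2)$. For a positive integer $n$ let $\sigma$ be one of the four permutations $$\begin{pmatrix} n & n+1 & n+2 & n+3\\ n+3 & n & n+1 & n+2\end{pmatrix},\quad \begin{pmatrix} n & n+1 & n+2 & n+3\\ n & n+3 & n+1 & n+2\end{pmatrix},$$ $$\begin{pmatrix} n & n+1 & n+2 & n+3\\ n+3 & n & n+2 & n+1\end{pmatrix},\quad \begin{pmatrix} n & n+1 & n+2 & n+3\\ n & n+3 & n+2 & n+1\end{pmatrix}.$$ Then: i) all the $\sigma$-permutated $n$th Fibonacci-Hurwitz quaternions $F_{n,\sigma}$ are invertible; ii) none of the $\sigma$-permutated $n$th Fibonacci-Hurwitz quaternions $F_{n,\sigma}$ is a unit.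
   Context: $(f_n)_{n\ge0}$ is the Fibonacci sequence: $f_0=0$, $f_1=1$, $f_n=f_{n-1}+f_{n-2}$ for $n\ge2$. $\mathbb{H}_{\mathbb{Q}(i)}(-1,-2)$ is the 4-dimensional associative unital $\mathbb{Q}(i)$-algebra with basis $\{1,e_2,e_3,e_4\}$ and $e_2^2=-1$, $e_3^2=-2$, $e_2e_3=-e_3e_2=e_4$; the norm of $x=x_1+x_2e_2+x_3e_3+x_4e_4$ is $\mathbf{n}(x)=x_1^2+x_2^2+2x_3^2+2x_4^2$. For a positive integer $n$ and a permutation $\sigma$ of the set $\{n,n+1,n+2,n+3\}$, the $\sigma$-permutated $n$th Fibonacci-Hurwitz quaternion is $$F_{n,\sigma}=\tfrac12 f_{\sigma(n)}+\tfrac12 f_{\sigma(n+1)}e_2+\tfrac12 f_{\sigma(n+2)}e_3+\tfrac12 f_{\sigma(n+3)}e_4.$$ In the two-row notation for $\sigma$, each element of the top row is mapped to the element below it. Here ''unit'' is the paper's terminology and does not mean invertible: a quaternion $q$ is called a unit if $\mathbf{n}(q)=1$. ''Invertible'' means having a two-sided multiplicative inverse in the algebra. *)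

(* Defs.v *)
From HB Require Import structures.
From mathcomp Require Import all_boot all_order all_algebra all_fingroup ring.
From mathcomp Require Import complex.

Set Implicit Arguments.
Unset Strict Implicit.
Unset Printing Implicit Defensive.

Import GRing.Theory.

Local Open Scope ring_scope.

Fixpoint fib (n : nat) : nat :=
  match n with
  | 0 => 0
  | 1 => 1
  | (m.+1 as k).+1 => fib k + fib m
  end%N.

(* H_K(a, b): the coordinates are those in the basis 1, e2, e3, e4 with
   e2^2 = a, e3^2 = b and e2 e3 = - e3 e2 = e4. *)
Record quat (K : Type) (a b : K) : Type :=
  Quat { qc1 : K; qc2 : K; qc3 : K; qc4 : K }.

Arguments Quat {K a b}.

Section QuatChoice.
Variables (K : Type) (a b : K).

Definition quat_tuple (x : quat a b) : K * K * K * K :=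
  (qc1 x, qc2 x, qc3 x, qc4 x).
Definition tuple_quat (t : K * K * K * K) : quat a b :=
  let: (x1, x2, x3, x4) := t in Quat x1 x2 x3 x4.

Lemma quat_tupleK : cancel quat_tuple tuple_quat.
Proof. by case. Qed.
End QuatChoice.

HB.instance Definition _ (K : eqType) (a b : K) :=
  Equality.copy (quat a b) (can_type (@quat_tupleK K a b)).
HB.instance Definition _ (K : choiceType) (a b : K) :=
  Choice.copy (quat a b) (can_type (@quat_tupleK K a b)).

Section QuatAlgebra.
Variables (K : fieldType) (a b : K).
Local Notation H := (quat a b).
Implicit Types (x y z : H) (k : K).

Definition quat_add x y : H :=
  Quat (qc1 x + qc1 y) (qc2 x + qc2 y) (qc3 x + qc3 y) (qc4 x + qc4 y).
Definition quat_opp x : H := Quat (- qc1 x) (- qc2 x) (- qc3 x) (- qc4 x).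
Definition quat_scale k x : H :=
  Quat (k * qc1 x) (k * qc2 x) (k * qc3 x) (k * qc4 x).
Definition quat_mul x y : H :=
  let: Quat x1 x2 x3 x4 := x in
  let: Quat y1 y2 y3 y4 := y in
  Quat (x1 * y1 + a * (x2 * y2) + b * (x3 * y3) - a * b * (x4 * y4))
       (x1 * y2 + x2 * y1 - b * (x3 * y4) + b * (x4 * y3))
       (x1 * y3 + x3 * y1 + a * (x2 * y4) - a * (x4 * y2))
       (x1 * y4 + x4 * y1 + x2 * y3 - x3 * y2).

Let quat_addA : associative quat_add.
Proof. by move=> [????] [????] [????]; congr Quat => /=; ring. Qed.
Let quat_addC : commutative quat_add.
Proof. by move=> [????] [????]; congr Quat => /=; ring. Qed.
Let quat_add0 : left_id (Quat 0 0 0 0) quat_add.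
Proof. by move=> [????]; congr Quat => /=; ring. Qed.
Let quat_addN : left_inverse (Quat 0 0 0 0) quat_opp quat_add.
Proof. by move=> [????]; congr Quat => /=; ring. Qed.

HB.instance Definition _ :=
  GRing.isZmodule.Build H quat_addA quat_addC quat_add0 quat_addN.

Let quat_mulA : associative quat_mul.
Proof. by move=> [????] [????] [????]; congr Quat => /=; ring. Qed.
Let quat_mul1l : left_id (Quat 1 0 0 0) quat_mul.
Proof. by move=> [????]; congr Quat => /=; ring. Qed.
Let quat_mul1r : right_id (Quat 1 0 0 0) quat_mul.
Proof. by move=> [????]; congr Quat => /=; ring. Qed.
Let quat_mulDl : left_distributive quat_mul (@GRing.add H).
Proof. by move=> [????] [????] [????]; congr Quat => /=; ring. Qed.
Let quat_mulDr : right_distributive quat_mul (@GRing.add H).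
Proof. by move=> [????] [????] [????]; congr Quat => /=; ring. Qed.
Let quat_1neq0 : (Quat 1 0 0 0 : H) != 0.
Proof. by apply/eqP => -[] /eqP; rewrite oner_eq0. Qed.

HB.instance Definition _ :=
  GRing.Zmodule_isNzRing.Build H
    quat_mulA quat_mul1l quat_mul1r quat_mulDl quat_mulDr quat_1neq0.

Let quat_scaleA k l x : quat_scale k (quat_scale l x) = quat_scale (k * l) x.
Proof. by case: x => ????; congr Quat => /=; ring. Qed.
Let quat_scale1 : left_id 1 quat_scale.
Proof. by move=> [????]; congr Quat => /=; ring. Qed.
Let quat_scaleDr : right_distributive quat_scale +%R.
Proof. by move=> k [????] [????]; congr Quat => /=; ring. Qed.
Let quat_scaleDl x : {morph quat_scale^~ x : k l / k + l}.
Proof. by case: x => ???? k l; congr Quat => /=; ring. Qed.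

HB.instance Definition _ :=
  GRing.Zmodule_isLmodule.Build K H
    quat_scaleA quat_scale1 quat_scaleDr quat_scaleDl.

Let quat_scaleAl k x y : k *: (x * y) = (k *: x) * y.
Proof. by case: x y => ???? [????]; congr Quat => /=; ring. Qed.

HB.instance Definition _ := GRing.Lmodule_isLalgebra.Build K H quat_scaleAl.

Let quat_scaleAr k x y : k *: (x * y) = x * (k *: y).
Proof. by case: x y => ???? [????]; congr Quat => /=; ring. Qed.

HB.instance Definition _ := GRing.Lalgebra_isAlgebra.Build K H quat_scaleAr.

Definition e2 : H := Quat 0 1 0 0.
Definition e3 : H := Quat 0 0 1 0.
Definition e4 : H := Quat 0 0 0 1.

Definition quat_norm x : K :=
  qc1 x ^+ 2 - a * qc2 x ^+ 2 - b * qc3 x ^+ 2 + a * b * qc4 x ^+ 2.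

Lemma e2_sqr : e2 * e2 = a%:A.
Proof. by congr Quat => /=; ring. Qed.
Lemma e3_sqr : e3 * e3 = b%:A.
Proof. by congr Quat => /=; ring. Qed.
Lemma e2e3 : e2 * e3 = e4.
Proof. by congr Quat => /=; ring. Qed.
Lemma e3e2 : e3 * e2 = - e4.
Proof. by congr Quat => /=; ring. Qed.

Lemma quat_coordE (x1 x2 x3 x4 : K) :
  x1 *: 1 + x2 *: e2 + x3 *: e3 + x4 *: e4 = Quat x1 x2 x3 x4.
Proof. by congr Quat => /=; ring. Qed.

End QuatAlgebra.

Arguments e2 {K a b}.
Arguments e3 {K a b}.
Arguments e4 {K a b}.

Definition invertible (A : nzRingType) (x : A) : Prop :=
  exists y : A, x * y = 1 /\ y * x = 1.

(* Not invertibility (see [invertible]). *)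
Definition quat_unit (K : fieldType) (a b : K) (q : quat a b) : Prop :=
  quat_norm q = 1.

Notation "'Q(i)'" := (complex rat) : type_scope.

Notation HQi := (quat (-1 : Q(i)) (-2 : Q(i))).

Lemma HQi_normE (q : HQi) :
  quat_norm q = qc1 q ^+ 2 + qc2 q ^+ 2 + 2 * qc3 q ^+ 2 + 2 * qc4 q ^+ 2.
Proof. by rewrite /quat_norm; ring. Qed.

(* Permutations of {n, ..., n + 3} are the permutations of 'I_n.+4 supported
   on this set, i.e., the elements of Sym (window n). *)
Definition window (n : nat) : {set 'I_n.+4} := [set k : 'I_n.+4 | (n <= k)%N].

Definition bottom_row (n : nat) (s : {perm 'I_n.+4}) : seq nat :=
  [seq (s (inord k) : nat) | k <- [:: n; n + 1; n + 2; n + 3]%N].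

Definition FibHurwitz (n : nat) (s : {perm 'I_n.+4}) : HQi :=
  let f_ k : Q(i) := (fib (s (inord k)))%:R in
  (2^-1 * f_ n) *: 1 + (2^-1 * f_ (n + 1)%N) *: e2
  + (2^-1 * f_ (n + 2)%N) *: e3 + (2^-1 * f_ (n + 3)%N) *: e4.

(* Main.v *)
Require Import Defs.
From mathcomp Require Import all_boot all_order all_algebra all_fingroup.
From mathcomp Require Import complex.
From mathcomp Require Import ring.

(** In each of the four permutations the weight-one coordinates (those of [1]
    and [e2]) carry the outer Fibonacci numbers f_n, f_(n+3), and the
    weight-two coordinates (those of [e3] and [e4]) carry the inner ones
    f_(n+1), f_(n+2); the norm does not see the order inside either pair.
    Writing a = f_n and b = f_(n+1), the norm is in all four cases

      (a^2 + (a + 2b)^2 + 2b^2 + 2(a + b)^2) / 4 = b^2 + (a + b)^2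
                                               = f_(n+1)^2 + f_(n+2)^2,

    a sum of two squares of positive integers, hence an integer that is at
    least 2 ([FibHurwitz_norm]).  Since Q(i) has characteristic zero
    ([natr_Qi_inj]), this norm is neither 0 nor 1 there.  It is not 1, so the
    quaternion is not a unit; it is not 0, so the conjugate divided by the
    norm is an inverse ([quat_norm_neq0_invertible]). *)

Set Implicit Arguments.
Unset Strict Implicit.
Unset Printing Implicit Defensive.

Import GRing.Theory Num.Theory.

Local Open Scope ring_scope.

Section Conjugate.
Variables (K : fieldType) (a b : K).
Implicit Types x : quat a b.

Definition quat_conj x : quat a b :=
  Quat (qc1 x) (- qc2 x) (- qc3 x) (- qc4 x).

Lemma mul_quat_conj x : x * quat_conj x = (quat_norm x)%:A.
Proof. by case: x => ????; congr Quat; rewrite /quat_norm /=; ring. Qed.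

Lemma mul_conj_quat x : quat_conj x * x = (quat_norm x)%:A.
Proof. by case: x => ????; congr Quat; rewrite /quat_norm /=; ring. Qed.

Lemma quat_norm_neq0_invertible x : quat_norm x != 0 -> invertible x.
Proof.
move=> nx0; exists ((quat_norm x)^-1 *: quat_conj x).
by rewrite -scalerAr -scalerAl mul_quat_conj mul_conj_quat scalerA mulVf // scale1r.
Qed.

End Conjugate.

(** Q(i) is not an ordered field, so characteristic zero is inherited from the
    rationals through the embedding of Q in Q(i), injective like every
    morphism of fields. *)
Lemma natr_Qi_inj : injective (fun m : nat => m%:R : Q(i)).
Proof.
move=> m p /=; rewrite -!(rmorph_nat (real_complex rat)) => /fmorph_inj /eqP.
by rewrite eqr_nat => /eqP.
Qed.

Lemma fib_gt0 n : (0 < n)%N -> (0 < fib n)%N.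
Proof. by elim: n => // -[//|n] IHn _; rewrite /= ltn_addr // IHn. Qed.

Lemma fibSS n : fib n.+2 = (fib n.+1 + fib n)%N.
Proof. by []. Qed.

(** The one place where the four permutations are inspected. In terms of
    f_n and f_(n+1) each case is the same quadratic identity, the factor 1/4
    from the halved coordinates cancelling exactly. *)
Lemma FibHurwitz_norm (n : nat) (s : {perm 'I_n.+4}) :
  bottom_row s \in [:: [:: n + 3; n; n + 1; n + 2];
                       [:: n; n + 3; n + 1; n + 2];
                       [:: n + 3; n; n + 2; n + 1];
                       [:: n; n + 3; n + 2; n + 1]]%N ->
  quat_norm (FibHurwitz s) = (fib n.+1 ^ 2 + fib n.+2 ^ 2)%:R.
Proof.
rewrite HQi_normE /FibHurwitz quat_coordE /bottom_row /= !inE.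
by case/or4P => /eqP[-> -> -> ->];
  rewrite ?(addn1, addn2, addn3) !fibSS ?natrD ?natrX ?natrD; field.
Qed.

Theorem corollary5p2 (n : nat) (s : {perm 'I_n.+4}) :
  (0 < n)%N ->
  s \in Sym (window n) ->
  bottom_row s \in [:: [:: n + 3; n; n + 1; n + 2];
                       [:: n; n + 3; n + 1; n + 2];
                       [:: n + 3; n; n + 2; n + 1];
                       [:: n; n + 3; n + 2; n + 1]]%N ->
  invertible (FibHurwitz s) /\ ~ quat_unit (FibHurwitz s).
Proof.
move=> _ _ /FibHurwitz_norm normE.
have norm_gt1 : (1 < fib n.+1 ^ 2 + fib n.+2 ^ 2)%N.
  by rewrite (@leq_add 1 1) // expn_gt0 fib_gt0.
split.
  apply: quat_norm_neq0_invertible; rewrite normE.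
  by apply/eqP => /(@natr_Qi_inj _ 0) norm0; rewrite norm0 in norm_gt1.
rewrite /quat_unit normE => /(@natr_Qi_inj _ 1) norm1.
by rewrite norm1 in norm_gt1.
Qed.
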